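(* If $S$ is a finite $0$-simple semigroup, then $$N(S)=M(S)=M'(S)=N'(S)\le 2 .$$
   Context: A semigroup $S$ is $0$-simple if it has a zero $0$, $S^2\ne \{0\}$, and $\{0\}$ and $S$ are its only ideals. A generating set of a finite semigroup $S$ is a non-empty subset $A\subseteq S$ such that every element of $S$ is a product of one or more elements of $A$; it is minimal if no proper subset is a generating set; $\mathrm{rank}(S)$ is the smallest cardinality of a generating set. For a generating set $A$ and $s\in S$, the length $l_A(s)$ is the least $k$ such that $s=a_1\cdots a_k$ with $a_i\in A$, except that the identity element of $S$ (if there is one) has length $0$ by convention. $\ker(S)$ is the minimum ideal of $S$ and $N(S,A)=\min\{l_A(s): s\in\ker(S)\}$. The depth parameters are: $N(S)$ and $M(S)$, respectively the minimum and the maximum of $N(S,A)$ over all generating sets $A$ with $|A|=\mathrm{rank}(S)$; $N'(S)$ and $M'(S)$, respectively the minimum and the maximum of $N(S,A)$ over all minimal generating sets $A$. *)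

(* Defs.v *)
From HB Require Import structures.
From mathcomp Require Import all_boot all_order.
From mathcomp Require Import boolp classical_sets.

Set Implicit Arguments.
Unset Strict Implicit.
Unset Printing Implicit Defensive.

Local Open Scope group_scope.

#[short(type="finSemigroupType")]
HB.structure Definition FinSemigroup := {S of Finite S & Semigroup S}.

(* Both are 0 when there is no minimum (maximum). When S is nonempty and A is a
   generating set, all the minima and maxima taken below exist. *)
Definition natmin (P : nat -> Prop) : nat := xget 0%N (P `&` lbound P)%classic.
Definition natmax (P : nat -> Prop) : nat := xget 0%N (P `&` ubound P)%classic.

Lemma natminP (P : nat -> Prop) (n : nat) :
  P n -> P (natmin P) /\ forall m, P m -> (natmin P <= m)%N.
Proof.
move=> Pn; have exP : exists m, `[< P m >] by exists n; apply/asboolP.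
suff /(@xgetPex _ 0%N)[PN leN] : exists m, (P `&` lbound P)%classic m.
  by split=> // m Pm; rewrite -leEnat; apply: leN.
have [m /asboolP Pm minm] := ex_minnP exP; exists m; split=> // k Pk.
by rewrite leEnat; apply/minm/asboolP.
Qed.

Lemma natmaxP (P : nat -> Prop) (n b : nat) :
  P n -> (forall m, P m -> (m <= b)%N) ->
  P (natmax P) /\ forall m, P m -> (m <= natmax P)%N.
Proof.
move=> Pn leb; have exP : exists m, `[< P m >] by exists n; apply/asboolP.
have lebb m : `[< P m >] -> (m <= b)%N by move/asboolP/leb.
suff /(@xgetPex _ 0%N)[PN leN] : exists m, (P `&` ubound P)%classic m.
  by split=> // m Pm; rewrite -leEnat; apply: leN.
have [m /asboolP Pm maxm] := ex_maxnP exP lebb; exists m; split=> // k Pk.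
by rewrite leEnat; apply/maxm/asboolP.
Qed.

Section Depth.

Variable S : finSemigroupType.
Implicit Types (A B I K : {set S}) (s z e : S) (k : nat).

Definition is_zero z := forall x, z * x = z /\ x * z = z.

Definition is_identity e := forall x, e * x = x /\ x * e = x.

(* Ideals are nonempty, so that {0} and S can be the only ones. *)
Definition ideal I :=
  I != finset.set0 /\ forall x s, x \in I -> s * x \in I /\ x * s \in I.

Definition zero_simple :=
  exists z, [/\ is_zero z,
    [set x * y | x in [set: S], y in [set: S]]%SET <> [set z]%SET
    & forall I, ideal I -> I = [set z]%SET \/ I = [set: S]%SET].

(* s = a_1 * ... * a_k with k > 0 and all a_i in A *)
Definition product_of A k s :=
  exists a (w : seq S),
    [/\ {subset a :: w <= A}, size (a :: w) = k & foldl *%g a w = s].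

Definition generating A :=
  A != finset.set0 /\ forall s, exists k, product_of A k s.

Definition minimal_generating A :=
  generating A /\ forall B, B \proper A -> ~ generating B.

Definition rank := natmin (fun n => exists2 A, generating A & n = #|A|).

Definition length A s : nat :=
  if `[< is_identity s >] then 0%N else natmin (fun k => product_of A k s).

Definition minimum_ideal K := ideal K /\ forall I, ideal I -> K \subset I.

Definition kernel : {set S} := xget finset.set0 minimum_ideal.

Lemma kernelP : S -> minimum_ideal kernel.
Proof.
move=> x0; apply: xgetPex.
pose J := [set x : S | `[< forall I, ideal I -> x \in I >]]%SET.
have JP x : reflect (forall I, ideal I -> x \in I) (x \in J).
  by rewrite inE; apply: asboolP.
exists J; split; last by move=> I idI; apply/fintype.subsetP=> x /JP; apply.
split; last first.
  by move=> x s /JP Jx; split; apply/JP => I idI;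
     have [l r] := idI.2 x s (Jx I idI).
apply/set0Pn; exists (foldl *%g x0 (enum S)); apply/JP=> I [/set0Pn[y Iy] idI].
have closed w x : x \in I -> foldl *%g x w \in I.
  by elim: w x => //= a w IHw x Ix; apply: IHw; case: (idI x a Ix).
have : y \in enum S by rewrite mem_enum.
case/splitPr=> w1 w2; rewrite foldl_cat /=.
by apply: closed; case: (idI y (foldl *%g x0 w1) Iy).
Qed.

(* N(S, A) *)
Definition depth A := natmin (fun n => exists2 s, s \in kernel & n = length A s).

(* N(S), M(S), N'(S) and M'(S) *)
Definition depthN :=
  natmin (fun n => exists A, [/\ generating A, #|A| = rank & n = depth A]).

Definition depthM :=
  natmax (fun n => exists A, [/\ generating A, #|A| = rank & n = depth A]).

Definition depthN' :=
  natmin (fun n => exists2 A, minimal_generating A & n = depth A).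

Definition depthM' :=
  natmax (fun n => exists2 A, minimal_generating A & n = depth A).

End Depth.

(* Main.v *)
Require Import Defs.
From mathcomp Require Import all_boot all_order.
From mathcomp Require Import boolp.

(** The kernel of a finite 0-simple semigroup [S] is [{0}], so [depth A] is the
    least length of a product of members of [A] that equals [0]. This number is
    the same for all minimal generating sets [A], and it depends only on whether
    [S] has zero divisors.

    Without zero divisors, a product is [0] only if one of its factors is, so
    every generating set contains [0] and has depth 1. With zero divisors [x]
    and [y], [x * y = 0], a minimal generating set [A] cannot contain [0], which
    is already the product of [x] and [y], and these are products of members
    of [A] other than [0]. So the depth is at least 2. It is exactly 2: if [a]
    is the last factor of [x] and [b] the first factor of [y], then
    0-simplicity and finiteness ([zs_factorr], [zs_factorl]) give [a] in [S^1 x]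
    and [b] in [y S^1], whence [a * b] lies in [S^1 x y S^1 = {0}].

    Generating sets of least cardinality are minimal, so all four parameters are
    extrema of one and the same nonempty constant family of depths. *)

Set Implicit Arguments.
Unset Strict Implicit.
Unset Printing Implicit Defensive.

Local Open Scope group_scope.

(** * Extrema of a constant family *)

Lemma natmin_const (P : nat -> Prop) d :
  P d -> (forall m, P m -> m = d) -> natmin P = d.
Proof. by move=> Pd eqd; have [/eqd] := natminP Pd. Qed.

Lemma natmax_const (P : nat -> Prop) d :
  P d -> (forall m, P m -> m = d) -> natmax P = d.
Proof.
move=> Pd eqd; have led m : P m -> (m <= d)%N by move/eqd->.
by have [/eqd] := natmaxP Pd led.
Qed.

(** * Products and generating sets *)

Section Products.

Variable S : finSemigroupType.
Implicit Types (A B : {set S}) (a b s x y z : S) (w : seq S).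

Lemma foldl_mulgA x a w : foldl *%g (x * a) w = x * foldl *%g a w.
Proof. by elim: w a => //= b w IHw a; rewrite -mulgA IHw. Qed.

Lemma product_of_mul A k l x y :
  product_of A k x -> product_of A l y -> product_of A (k + l) (x * y).
Proof.
move=> [a [w [wA <- <-]]] [b [v [vA <- <-]]]; exists a, (w ++ b :: v).
split; last by rewrite foldl_cat /= foldl_mulgA.
  by move=> c; rewrite -cat_cons mem_cat => /orP[/wA|/vA].
by rewrite -cat_cons size_cat.
Qed.

Lemma product_of0 A s : ~ product_of A 0 s.
Proof. by case=> a [w []]. Qed.

Lemma product_of1 A s : product_of A 1 s <-> s \in A.
Proof.
split=> [[a [[|b w] [wA // _ <-]]]|As]; first by apply: wA; rewrite inE eqxx.
by exists s, [::]; split=> // b; rewrite inE => /eqP->.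
Qed.

Lemma product_of_first A k s : product_of A k s ->
  exists2 b, b \in A & s = b \/ exists q, s = b * q.
Proof.
move=> [a [w [wA _ <-]]]; exists a; first by apply: wA; rewrite mem_head.
case: w wA => [|b w] _; first by left.
by right; exists (foldl *%g b w); rewrite -foldl_mulgA.
Qed.

Lemma product_of_last A k s : product_of A k s ->
  exists2 a, a \in A & s = a \/ exists p, s = p * a.
Proof.
move=> [a [w [wA _ <-]]]; case/lastP: w wA => [|w b] wA.
  by exists a; [apply: wA; rewrite mem_head | left].
exists b; first by apply: wA; rewrite inE mem_rcons mem_head orbT.
by right; exists (foldl *%g a w); rewrite foldl_rcons.
Qed.

Lemma foldl_mulg_zero z a w : is_zero z -> z \in a :: w -> foldl *%g a w = z.
Proof.
move=> z0; have absorb v : foldl *%g z v = z.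
  by elim: v => //= b v; rewrite (z0 b).1.
elim: w a => [|b w IHw] a; first by rewrite inE => /eqP.
rewrite inE => /predU1P[<-|zw]; first exact: absorb.
by rewrite /= foldl_mulgA IHw // (z0 a).2.
Qed.

Lemma zero_in_product z a w : (forall x y, x * y = z -> x = z \/ y = z) ->
  foldl *%g a w = z -> z \in a :: w.
Proof.
move=> nodiv; elim: w a => [|b w IHw] a /=; first by move=> ->; rewrite mem_head.
rewrite foldl_mulgA => /nodiv[->|/IHw zw]; first exact: mem_head.
by rewrite inE zw orbT.
Qed.

Lemma product_of_setD1 A z k s : is_zero z -> s <> z ->
  product_of A k s -> product_of (A :\ z) k s.
Proof.
move=> z0 nsz [a [w [wA sz ws]]]; exists a, w; split=> // b wb.
rewrite in_setD1 wA // andbT; apply/eqP=> bz; apply: nsz.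
by rewrite -ws; apply: foldl_mulg_zero; rewrite // -bz.
Qed.

Lemma generating_setT : S -> generating [set: S].
Proof.
move=> x0; split; first by apply/set0Pn; exists x0.
by move=> s; exists 1%N; apply/product_of1.
Qed.

Lemma rank_spec A : generating A ->
  (exists2 B : {set S}, generating B & #|B| = rank S) /\ (rank S <= #|A|)%N.
Proof.
move=> gA; pose P n := exists2 B : {set S}, generating B & n = #|B|.
have PA : P #|A| by exists A.
have [[B gB eqB] minP] := natminP PA.
by split; [exists B | apply: minP].
Qed.

Lemma rank_minimal A : generating A -> #|A| = rank S -> minimal_generating A.
Proof.
move=> gA cA; split=> // B /proper_card ltBA /rank_spec[_].
by rewrite cA in ltBA; rewrite leqNgt ltBA.
Qed.

(** * Stability of finite semigroups *)

(** The left ideal [S^1 a] is contained in [S^1 u p a v], so it is no larger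
    than [S^1 u p a]; as it contains the latter, the two coincide. *)
Lemma stable_left u p a v : a = u * (p * a) * v -> exists q, a = q * (p * a).
Proof.
move=> eqa; pose L x := x |: [set s * x | s in [set: S]]%SET.
pose c := u * (p * a).
have sLca : L c \subset L a.
  rewrite /L /c mulgA; apply/fintype.subsetP=> y /setU1P[->|/imsetP[s _ ->]].
    by rewrite setU1r //; apply: imset_f.
  by rewrite mulgA setU1r //; apply: imset_f.
have sLaLcv : L a \subset [set y * v | y in L c]%SET.
  apply/fintype.subsetP=> y /setU1P[->|/imsetP[s _ ->]].
    by apply/imsetP; exists c; first exact: setU11.
  apply/imsetP; exists (s * c); first by rewrite setU1r //; apply: imset_f.
  by rewrite {1}eqa mulgA.
have eqL : L c = L a.
  apply/eqP; rewrite eqEcard sLca /=.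
  exact: leq_trans (subset_leq_card sLaLcv) (leq_imset_card _ _).
have : a \in L c by rewrite eqL setU11.
case/setU1P=> [ac|/imsetP[s _ as_]]; first by exists u.
by exists (s * u); rewrite -mulgA.
Qed.

(** The left-right dual of [stable_left]. *)
Lemma stable_right u p a v : a = u * (a * p) * v -> exists q, a = a * p * q.
Proof.
rewrite -mulgA => eqa; pose R x := x |: [set x * s | s in [set: S]]%SET.
pose c := a * p * v.
have sRca : R c \subset R a.
  rewrite /R /c -mulgA; apply/fintype.subsetP=> y /setU1P[->|/imsetP[s _ ->]].
    by rewrite setU1r //; apply: imset_f.
  by rewrite -mulgA setU1r //; apply: imset_f.
have sRauRc : R a \subset [set u * y | y in R c]%SET.
  apply/fintype.subsetP=> y /setU1P[->|/imsetP[s _ ->]].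
    by apply/imsetP; exists c; first exact: setU11.
  apply/imsetP; exists (c * s); first by rewrite setU1r //; apply: imset_f.
  by rewrite {1}eqa -mulgA.
have eqR : R c = R a.
  apply/eqP; rewrite eqEcard sRca /=.
  exact: leq_trans (subset_leq_card sRauRc) (leq_imset_card _ _).
have : a \in R c by rewrite eqR setU11.
case/setU1P=> [ac|/imsetP[s _ as_]]; first by exists v.
by exists (v * s); rewrite mulgA.
Qed.

End Products.

(** * Zero-simple semigroups *)

Section ZeroSimple.

Variables (S : finSemigroupType) (z : S).
Hypothesis z0 : is_zero z.
Hypothesis sq_neq0 :
  [set x * y | x in [set: S], y in [set: S]]%SET <> [set z]%SET.
Hypothesis simpleS : forall I, ideal I -> I = [set z]%SET \/ I = [set: S]%SET.
Implicit Types (A : {set S}) (a b s t x y : S).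

Lemma zs_ideal_setT (I : {set S}) x : ideal I -> x \in I -> x <> z -> I = [set: S]%SET.
Proof. by move=> /simpleS[->|//]; rewrite inE => /eqP. Qed.

Lemma zs_nonzero_product : exists x y, x * y <> z.
Proof.
apply: contrapT => none; apply: sq_neq0; apply/setP=> s; rewrite inE.
apply/imset2P/eqP=> [[x y _ _ ->]|->]; last by exists z z; rewrite ?inE // (z0 z).1.
by apply: contrapT => nxy; apply: none; exists x, y.
Qed.

Lemma zs_square s : exists x y, s = x * y.
Proof.
have [x [y nxy]] := zs_nonzero_product.
pose I := [set x * y | x in [set: S], y in [set: S]]%SET.
have idI : ideal I.
  split; first by apply/set0Pn; exists (x * y); apply: imset2_f.
  move=> _ t /imset2P[a b _ _ ->]; split.
    by rewrite mulgA; apply: imset2_f.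
  by rewrite -mulgA; apply: imset2_f.
have : s \in I by rewrite (zs_ideal_setT idI _ nxy) //; apply: imset2_f.
by case/imset2P=> a b _ _ ->; exists a, b.
Qed.

(** The elements [t] with [S t S = {0}] form an ideal. It is not all of [S],
    since [S = S S = S S S], so it is [{0}]. *)
Lemma zs_sandwich_neq0 t : t <> z -> exists x y, x * t * y <> z.
Proof.
move=> nt; apply: contrapT => none.
pose J := [set t | [forall x, forall y, x * t * y == z]]%SET.
have JP s : reflect (forall x y, x * s * y = z) (s \in J).
  rewrite inE; apply: (iffP forallP) => [H x y|H x].
    by have /forallP/(_ y)/eqP := H x.
  by apply/forallP=> y; rewrite H.
have Jt : t \in J.
  by apply/JP=> x y; apply: contrapT => nxy; apply: none; exists x, y.
have idJ : ideal J.
  split; first by apply/set0Pn; exists t.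
  move=> s r /JP Js; split; apply/JP=> x y; first by rewrite mulgA Js.
  by rewrite mulgA -(mulgA (x * s)) Js.
have [x [y nxy]] := zs_nonzero_product; apply: nxy.
have [a [b ->]] := zs_square x.
by apply/JP; rewrite (zs_ideal_setT idJ Jt nt).
Qed.

Lemma zs_sandwich t s : t <> z -> exists x y, s = x * t * y.
Proof.
move=> nt; have [x [y nxy]] := zs_sandwich_neq0 nt.
pose I := [set x * t * y | x in [set: S], y in [set: S]]%SET.
have Ixy : x * t * y \in I by apply: imset2_f.
have idI : ideal I.
  split; first by apply/set0Pn; exists (x * t * y).
  move=> _ r /imset2P[a b _ _ ->]; split.
    by rewrite !mulgA; apply: (imset2_f (fun x y => x * t * y)).
  by rewrite -mulgA; apply: (imset2_f (fun x y => x * t * y)).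
have : s \in I by rewrite (zs_ideal_setT idI Ixy nxy).
by case/imset2P=> a b _ _ ->; exists a, b.
Qed.

(** By 0-simplicity [a] lies in [S p a S], and stability removes the factor on
    the far side. *)
Lemma zs_factorr p a : p * a <> z -> exists q, a = q * (p * a).
Proof. by move=> /(zs_sandwich a)[u [v]]; apply: stable_left. Qed.

Lemma zs_factorl p a : a * p <> z -> exists q, a = a * p * q.
Proof. by move=> /(zs_sandwich a)[u [v]]; apply: stable_right. Qed.

Lemma zs_kernel : kernel S = [set z]%SET.
Proof.
have [[n0 _] /(_ [set z]%SET) sK] := kernelP z.
have idz : ideal [set z]%SET.
  split; first by apply/set0Pn; exists z; rewrite set11.
  by move=> x s /set1P->; rewrite (z0 s).1 (z0 s).2 set11.
by move: (sK idz); rewrite subset1 (negPf n0) orbF => /eqP.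
Qed.

Lemma zs_zero_not_identity : ~ is_identity z.
Proof.
move=> id_z; have [x [y]] := zs_nonzero_product; apply.
by rewrite -(id_z (x * y)).1 (z0 _).1.
Qed.

Lemma zs_depth A : depth A = natmin (fun k => product_of A k z).
Proof.
(* The zero is not the identity, so its length is not 0 by convention. *)
have len_z : length A z = natmin (fun k => product_of A k z).
  by rewrite /length asboolF //; apply: zs_zero_not_identity.
rewrite -len_z; apply: natmin_const => [|m [s]].
  by exists z; rewrite // zs_kernel set11.
by rewrite zs_kernel => /set1P-> ->.
Qed.

Lemma zs_depth_eq A d : product_of A d z ->
  (forall k, product_of A k z -> (d <= k)%N) -> depth A = d.
Proof.
rewrite zs_depth => Ad led; have [Am lem] := @natminP (fun k => product_of A k z) d Ad.
by apply/eqP; rewrite eqn_leq lem // led.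
Qed.

Lemma depth_no_zero_divisor A : (forall x y, x * y = z -> x = z \/ y = z) ->
  generating A -> depth A = 1%N.
Proof.
move=> nodiv [_ gA]; have [_ [a [w [wA _ /(zero_in_product nodiv)/wA Az]]]] := gA z.
apply: zs_depth_eq; first exact/product_of1.
by case=> // /product_of0.
Qed.

(** [A] minus [z] still generates: a nonzero product has no factor [z], and [z]
    itself is [x * y], a product of two such products. *)
Lemma zero_notin_minimal A x y : x <> z -> y <> z -> x * y = z ->
  minimal_generating A -> z \notin A.
Proof.
move=> nx ny xy0 [[_ gA] minA]; apply/negP=> Az.
apply: (minA (A :\ z)); first exact: properD1.
have gen_nz s : s <> z -> exists k, product_of (A :\ z) k s.
  by move=> ns; have [k Ak] := gA s; exists k; apply: product_of_setD1.
split=> [|s].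
  have [k /product_of_first[b Ab _]] := gen_nz x nx.
  by apply/set0Pn; exists b.
have [->|/eqP ns] := eqVneq s z; last exact: gen_nz ns.
have [k Ak] := gen_nz x nx; have [l Al] := gen_nz y ny.
by exists (k + l)%N; have := product_of_mul Ak Al; rewrite xy0.
Qed.

(** Take [a] the last factor of [x] and [b] the first factor of [y]. Then [a] is
    [x] or [q * x], so [a * y = z]; likewise [b] is [y] or [y * q], so
    [a * b = z]. *)
Lemma generators_mul0 A x y : x <> z -> y <> z -> x * y = z ->
  generating A -> exists a b, [/\ a \in A, b \in A & a * b = z].
Proof.
move=> nx ny xy0 [_ gA].
have [_ /product_of_last[a Aa xa]] := gA x.
have [_ /product_of_first[b Ab yb]] := gA y.
have ay0 : a * y = z.
  case: xa => [<- //|[p xpa]]; have [|q ->] := @zs_factorr p a; first by rewrite -xpa.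
  by rewrite -xpa -mulgA xy0 (z0 q).2.
exists a, b; split=> //; case: yb => [<- //|[p ybp]].
have [|q ->] := @zs_factorl p b; first by rewrite -ybp.
by rewrite -ybp mulgA ay0 (z0 q).1.
Qed.

Lemma depth_zero_divisor A x y : x <> z -> y <> z -> x * y = z ->
  minimal_generating A -> depth A = 2%N.
Proof.
move=> nx ny xy0 mA; have nAz := zero_notin_minimal nx ny xy0 mA.
have [a [b [Aa Ab ab0]]] := generators_mul0 nx ny xy0 mA.1.
apply: zs_depth_eq.
  by rewrite -ab0 -[2%N]/(1 + 1)%N; apply: product_of_mul; apply/product_of1.
by case=> [/product_of0|[/product_of1|]] //; rewrite (negPf nAz).
Qed.

Lemma depth_minimal_const : exists2 d, (d <= 2)%N &
  forall A, minimal_generating A -> depth A = d.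
Proof.
have [nodiv|div] := pselect (forall x y, x * y = z -> x = z \/ y = z).
  by exists 1%N => // A [gA _]; apply: depth_no_zero_divisor.
suff [x [y [nx ny xy0]]] : exists x y, [/\ x <> z, y <> z & x * y = z].
  by exists 2%N => // A; apply: (depth_zero_divisor nx ny).
apply: contrapT => none; apply: div => x y xy0.
have [->|/eqP nx] := eqVneq x z; first by left.
have [->|/eqP ny] := eqVneq y z; first by right.
by case: none; exists x, y.
Qed.

End ZeroSimple.

Theorem lemma3p2 (S : finSemigroupType) :
  zero_simple S ->
  [/\ depthN S = depthM S, depthM S = depthM' S, depthM' S = depthN' S
    & (depthN' S <= 2)%N].
Proof.
move=> [z [z0 sq_neq0 simpleS]].
have [d led depth_d] := depth_minimal_const z0 sq_neq0 simpleS.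
have [A gA cA] := (rank_spec (generating_setT z)).1.
have mA := rank_minimal gA cA.
have depthA := esym (depth_d A mA).
have rank_d (B : {set S}) : generating B -> #|B| = rank S -> depth B = d.
  by move=> gB cB; apply: depth_d; apply: rank_minimal.
have -> : depthN S = d.
  by apply: natmin_const => [|m [B [gB cB ->]]]; [exists A | apply: rank_d].
have -> : depthM S = d.
  by apply: natmax_const => [|m [B [gB cB ->]]]; [exists A | apply: rank_d].
have -> : depthN' S = d.
  by apply: natmin_const => [|m [B mB ->]]; [exists A | apply: depth_d].
have -> : depthM' S = d.
  by apply: natmax_const => [|m [B mB ->]]; [exists A | apply: depth_d].
by [].
Qed.
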